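(* Let $n\in\mathbb{Z}_{\ge0}$. For $n$ even, the values of $\mathrm{Cay}_n(s;n)$ for $s=0,\pm2,\ldots,\pm(n-2),\pm n$ are as follows. If $n\equiv0\pmod4$: $$\mathrm{Cay}_n(s;n)=\begin{cases}n! & \text{if } s=0,\pm4,\ldots,\pm(n-4),\pm n,\\ -n! & \text{if } s=\pm2,\pm6,\ldots,\pm(n-2).\end{cases}$$ If $n\equiv2\pmod4$: $$\mathrm{Cay}_n(s;n)=\begin{cases}-n! & \text{if } s=0,\pm4,\ldots,\pm(n-2),\\ n! & \text{if } s=\pm2,\pm6,\ldots,\pm(n-4),\pm n.\end{cases}$$ For $n$ odd, the values of $\mathrm{Cay}_n(s;n)$ for $s=\pm1,\pm3,\ldots,\pm(n-2),\pm n$ are as follows. If $n\equiv1\pmod4$: $$\mathrm{Cay}_n(s;n)=\begin{cases}n! & \text{if } s=1,-3,5,\ldots,-(n-2),n,\\ -n! & \text{if } s=-1,3,-5,\ldots,n-2,-n.\end{cases}$$ If $n\equiv3\pmod4$: $$\mathrm{Cay}_n(s;n)=\begin{cases}-n! & \text{if } s=1,-3,5,\ldots,n-2,-n,\\ n! & \text{if } s=-1,3,-5,\ldots,-(n-2),n.\end{cases}$$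
   Context: Cayley continuants: $\mathrm{Cay}_0(x;y)=1$, and for $k\ge1$, $\mathrm{Cay}_k(x;y)$ is the determinant of the $k\times k$ tridiagonal matrix with all diagonal entries equal to $x$, entry $i$ in position $(i,i+1)$, and entry $y-i+1$ in position $(i+1,i)$ $(1\le i\le k-1)$. Each list consists of all integers $s$ with $|s|\le n$, $s\equiv n \pmod 2$ in the indicated residue class modulo 4 (for instance, for $n\equiv 1\pmod 4$ the list $1,-3,5,\ldots,n$ consists of those $s$ with $s\equiv1\pmod4$). *)

(* Defs.v *)
From HB Require Import structures.
From mathcomp Require Import all_boot all_order all_algebra.
Set Implicit Arguments.
Unset Strict Implicit.
Unset Printing Implicit Defensive.
Import Order.TTheory GRing.Theory Num.Theory.
Local Open Scope ring_scope.

(* Rows and columns are numbered from 0 here: with 1-based indices, entry     *)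
(* i at (i, i+1) is i.+1 at (i, i.+1), and entry y - i + 1 at (i+1, i) is     *)
(* y - j at (j.+1, j).                                                        *)
Definition Cay_mx (R : comNzRingType) (k : nat) (x y : R) : 'M[R]_k :=
  \matrix_(i < k, j < k)
    if val i == val j then x
    else if val j == (val i).+1 then (val i).+1%:R
    else if val i == (val j).+1 then y - (val j)%:R
    else 0.

Definition Cay (R : comNzRingType) (k : nat) (x y : R) : R :=
  \det (Cay_mx k x y).

Lemma Cay0 (R : comNzRingType) (x y : R) : Cay 0 x y = 1.
Proof. exact: det_mx00. Qed.

(* Main.v *)
Require Import Defs.
From HB Require Import structures.
From mathcomp Require Import all_boot all_order all_algebra.
From mathcomp Require Import zify ring.
Set Implicit Arguments.
Unset Strict Implicit.
Unset Printing Implicit Defensive.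
Import Order.TTheory GRing.Theory Num.Theory.
Local Open Scope ring_scope.

(** Since |s| <= n and s has the parity of n, write n = a + b and s = a - b
    with naturals a and b.  All the cases then say that
    Cay_n(a - b; a + b) = (-1)^b n!.

    Expanding the tridiagonal determinant gives the three-term recurrence
    [Cay_rec].  Divided by factorials, it is the coefficientwise form of the
    differential equation (1 - t^2) F' = (x - y t) F with F(0) = 1.  At x = a - b
    and y = a + b its solution is the polynomial (1 + t)^a (1 - t)^b, whence
    [Cay_coef]: Cay_k(a - b; a + b) is k! times the coefficient of t^k, for every
    k.  At k = a + b this is the coefficient of highest degree, namely (-1)^b
    ([Cay_gen_top]). *)

(** Laplace expansion along the last row, which has two nonzero entries.
    Deleting it together with the column of its off-diagonal entry leaves a
    matrix whose last column has a single nonzero entry, k + 1, so a second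
    expansion reaches the continuant of size k. *)
Lemma Cay_rec (R : comNzRingType) (k : nat) (x y : R) :
  Cay k.+2 x y = x * Cay k.+1 x y - k.+1%:R * (y - k%:R) * Cay k x y.
Proof.
rewrite /Cay (expand_det_row _ ord_max) !big_ord_recr /= big1 ?add0r; last first.
  move=> i _; rewrite mxE /=.
  do 3 (case: ifP => [/eqP|_]; first by have := ltn_ord i; lia).
  exact: mul0r.
rewrite addrC; congr (_ + _).
  rewrite mxE eqxx /cofactor /= addnn -signr_odd odd_double expr0 mul1r.
  congr (_ * \det _); apply/matrixP=> i j; rewrite !mxE /= /bump.
  by rewrite [(k < i)%N]leqNgt [(k < j)%N]leqNgt !ltn_ord.
rewrite mxE /= /cofactor /= addSn addnn -signr_odd /= odd_double expr1.
rewrite (expand_det_col _ ord_max) big_ord_recr /= big1 ?add0r; last first.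
  move=> i _; rewrite !mxE /= /bump.
  have hi := ltn_ord i.
  do 3 (case: ifP => [/eqP|_]; first by lia).
  exact: mul0r.
rewrite !mxE /= /cofactor /= addnn -signr_odd odd_double expr0 mul1r /bump.
rewrite ltnn leqnn add0n add1n eqxx !ifN ?eqxx; try lia.
(* What is left after both deletions is the leading block of size k. *)
set D := \det _; suff -> : D = \det (Cay_mx k x y) by ring.
congr (\det _); apply/matrixP=> i j; rewrite !mxE /= /bump.
have hi := ltn_ord i; have hj := ltn_ord j.
have -> : (k <= i)%N = false by lia.
have -> : (k <= j)%N = false by lia.
have -> : (k < false + i)%N = false by rewrite add0n; lia.
by have -> : (k <= false + j)%N = false by rewrite add0n; lia.
Qed.

Lemma Cay1 (R : comNzRingType) (x y : R) : Cay 1 x y = x.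
Proof. by rewrite /Cay det_mx11 mxE eqxx. Qed.

(** The generating function of Cay_k(a - b; a + b) / k!. *)
Definition Cay_gen (R : comNzRingType) (a b : nat) : {poly R} :=
  (1 + 'X) ^+ a * (1 - 'X) ^+ b.

(** Multiplying the derivative by p avoids the exponent a - 1, so that a = 0 is
    not a special case. *)
Lemma mul_deriv_exp (R : comNzRingType) (p : {poly R}) (a : nat) :
  p * (p ^+ a)^`() = p^`() * p ^+ a *+ a.
Proof.
case: a => [|a]; first by rewrite derivE mulr0.
by rewrite deriv_exp /= exprS mulrnAr; congr (_ *+ _); ring.
Qed.

(** The logarithmic derivative of the product is a / (1 + t) - b / (1 - t). *)
Lemma Cay_gen_deriv (R : comNzRingType) (a b : nat) :
  (1 - 'X ^+ 2) * (Cay_gen R a b)^`() =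
  ((a%:R - b%:R)%:P - (a%:R + b%:R)%:P * 'X) * Cay_gen R a b.
Proof.
rewrite /Cay_gen derivM.
have ha := mul_deriv_exp (1 + 'X : {poly R}) a.
have hb := mul_deriv_exp (1 - 'X : {poly R}) b.
rewrite !derivE add0r mul1r in ha; rewrite !derivE sub0r mulN1r in hb.
set p := (1 + 'X : {poly R}) ^+ a in ha *.
set q := (1 - 'X : {poly R}) ^+ b in hb *.
transitivity ((1 - 'X) * q * ((1 + 'X) * p^`()) +
    (1 + 'X) * p * ((1 - 'X) * q^`())).
  by ring.
rewrite ha hb -mulr_natr -[_ *+ b]mulr_natr rmorphB rmorphD /= !polyC_natr.
by ring.
Qed.

(** Both sides satisfy the recurrence of [Cay_rec]: the right-hand side by
    comparing coefficients in [Cay_gen_deriv].  Clearing denominators as k!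
    makes this valid over every commutative ring. *)
Lemma Cay_coef (R : comNzRingType) (a b k : nat) :
  Cay k (a%:R - b%:R) (a%:R + b%:R) = k`!%:R * (Cay_gen R a b)`_k.
Proof.
set P := Cay_gen R a b.
have P0 : P`_0 = 1.
  by rewrite -horner_coef0 /P /Cay_gen !hornerE subr0 !expr1n mulr1.
have hD j : (P^`() - 'X ^+ 2 * P^`())`_j =
    ((a%:R - b%:R)%:P * P - (a%:R + b%:R)%:P * ('X * P))`_j.
  by rewrite -[X in X - _]mul1r -mulrBl Cay_gen_deriv mulrA mulrBl.
have P1 : P`_1 = a%:R - b%:R.
  move: (hD 0); rewrite !coefB coefXnM coefCM coefCM coefXM.
  by rewrite coef_deriv P0 /= mulr1 mulr0 !subr0 mulr1n.
have rec j : P`_j.+2 *+ j.+2 =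
    (a%:R - b%:R) * P`_j.+1 - (a%:R + b%:R - j%:R) * P`_j.
  move: (hD j.+1); rewrite !coefB coefXnM coefCM coefCM coefXM.
  rewrite !coef_deriv /=.
  case: j => [|j] /=; first by rewrite !subr0.
  rewrite subn2 /= => /(canRL (subrK _)) ->; rewrite -mulr_natl; ring.
suff: Cay k (a%:R - b%:R) (a%:R + b%:R) = k`!%:R * P`_k /\
  Cay k.+1 (a%:R - b%:R) (a%:R + b%:R) = k.+1`!%:R * P`_k.+1 by case.
elim: k => [|k [IH0 IH1]]; first by rewrite Cay0 Cay1 P0 P1 !mul1r.
split=> //; rewrite Cay_rec IH0 IH1 [k.+2`!]factS natrM -[RHS]mulrA [RHS]mulrCA.
rewrite [_.+2%:R * _]mulr_natl rec.
by rewrite factS natrM; ring.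
Qed.

(** Up to the sign (-1)^b, the generating polynomial is a product of monic
    linear factors. *)
Lemma Cay_gen_top (R : idomainType) (a b : nat) :
  (Cay_gen R a b)`_(a + b) = (-1) ^+ b.
Proof.
have -> : Cay_gen R a b = (-1) ^+ b *: (('X - (-1)%:P) ^+ a * ('X - 1%:P) ^+ b).
  rewrite /Cay_gen -mul_polyC rmorphXn /= polyCN opprK addrC.
  by rewrite -[1 - 'X]opprB [(- _) ^+ b]exprNn mulrCA.
rewrite coefZ; set Q := (_ ^+ a * _ ^+ b : {poly R}).
have mQ : Q \is monic by rewrite monicMl ?monic_exp ?monicXsubC.
have sQ : size Q = (a + b).+1.
  rewrite size_monicM ?monic_neq0 ?monic_exp ?monicXsubC //.
  by rewrite !size_exp_XsubC addnS.
by move/monicP: mQ; rewrite lead_coefE sQ /= => ->; rewrite mulr1.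
Qed.

Lemma Cay_top (a b : nat) :
  Cay (a + b) (a%:Z - b%:Z) (a + b)%N%:Z = (-1) ^+ b * (a + b)`!%:Z.
Proof.
have := Cay_coef int a b (a + b).
rewrite Cay_gen_top -natrD !natz => ->; exact: mulrC.
Qed.

Theorem corollary1p29 (n : nat) (s : int)
    (hs : `|s| <= n%:Z) (hpar : (s = n%:Z %[mod 2])%Z) :
  [/\ (n = 0 %[mod 4])%N ->
        ((s = 0 %[mod 4])%Z -> Cay n s n%:Z = (n`!)%:Z) /\
        ((s = 2 %[mod 4])%Z -> Cay n s n%:Z = - (n`!)%:Z),
      (n = 2 %[mod 4])%N ->
        ((s = 0 %[mod 4])%Z -> Cay n s n%:Z = - (n`!)%:Z) /\
        ((s = 2 %[mod 4])%Z -> Cay n s n%:Z = (n`!)%:Z),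
      (n = 1 %[mod 4])%N ->
        ((s = 1 %[mod 4])%Z -> Cay n s n%:Z = (n`!)%:Z) /\
        ((s = -1 %[mod 4])%Z -> Cay n s n%:Z = - (n`!)%:Z)
    & (n = 3 %[mod 4])%N ->
        ((s = 1 %[mod 4])%Z -> Cay n s n%:Z = - (n`!)%:Z) /\
        ((s = -1 %[mod 4])%Z -> Cay n s n%:Z = (n`!)%:Z)].
Proof.
have [a [b [hn hsab]]] : exists a b : nat, n = (a + b)%N /\ s = a%:Z - b%:Z.
  by exists `|(n%:Z + s) %/ 2|%Z%N, `|(n%:Z - s) %/ 2|%Z%N; lia.
have -> : Cay n s n%:Z = (-1) ^+ odd b * (n`!)%:Z.
  by rewrite signr_odd hn hsab Cay_top.
move: (n`!)%:Z => f.
(* The residue of s = n - 2b modulo 4 and that of n fix the parity of b; the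
   cases with the other parity are contradictory. *)
have ob : b = (odd b + b./2.*2)%N by rewrite odd_double_half.
case: (odd b) ob => /= ob; rewrite ?expr1 ?expr0 ?mul1r ?mulN1r;
  split=> hn4; split=> hs4 //; exfalso; lia.
Qed.
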